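(* Let $(\Omega,\mathcal{F},\mathbb{P})$ be a probability space and let $\mathcal{X}\subseteq\mathbb{L}^0_+$ be convex, solid and bounded. Then the following are equivalent: (1) whenever $(X_n)_{n\in\mathbb{N}}$ is an $\mathcal{X}$-valued sequence converging to zero in $\mathbb{L}^0$, every sequence of forward convex combinations of $(X_n)_{n\in\mathbb{N}}$ also converges to zero in $\mathbb{L}^0$; (2) $0\in\mathcal{X}$ has a neighbourhood base, for the relative $\mathbb{L}^0$-topology on $\mathcal{X}$, consisting of convex sets; (3) every $X\in\mathcal{X}$ has a neighbourhood base, for the relative $\mathbb{L}^0$-topology on $\mathcal{X}$, consisting of convex sets; (4) there exists a probability $\mathbb{Q}$ equivalent to $\mathbb{P}$ such that the $\mathbb{L}^0$-topology on $\mathcal{X}$ coincides with the $\mathbb{L}^1(\mathbb{Q})$-topology on $\mathcal{X}$; (5) there exists a probability $\mathbb{Q}$ equivalent to $\mathbb{P}$ such that $\mathcal{X}$ is uniformly $\mathbb{Q}$-integrable.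
   Context: $\mathbb{L}^0$ is the space of (equivalence classes modulo $\mathbb{P}$-null sets of) real-valued random variables with the metric $(X,Y)\mapsto\mathbb{E}_{\mathbb{P}}[1\wedge|X-Y|]$ (topology of convergence in probability); $\mathbb{L}^0_+$ are its nonnegative elements. $\mathcal{X}\subseteq\mathbb{L}^0_+$ is solid if $Y\in\mathbb{L}^0_+$, $X\in\mathcal{X}$, $Y\le X$ imply $Y\in\mathcal{X}$; bounded if $\lim_{n\to\infty}\sup_{X\in\mathcal{X}}\mathbb{P}[|X|>n]=0$. A sequence of forward convex combinations of $(X_n)$ is any sequence $(Y_n)$ with $Y_n\in\mathrm{conv}\{X_k: k\ge n\}$ for all $n$. Uniform $\mathbb{Q}$-integrability means $\lim_{n\to\infty}\sup_{X\in\mathcal{X}}\mathbb{E}_{\mathbb{Q}}[|X|\mathbb{I}_{\{|X|>n\}}]=0$. *)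

(* Defs.v *)
From HB Require Import structures.
From mathcomp Require Import all_boot all_order all_algebra.
From mathcomp Require Import all_classical all_reals all_analysis.
Set Implicit Arguments. Unset Strict Implicit. Unset Printing Implicit Defensive.
Import Order.TTheory GRing.Theory Num.Theory.
Import numFieldNormedType.Exports.
Local Open Scope classical_set_scope.
Local Open Scope ring_scope.

(* Elements of L^0 are represented by measurable functions T -> R; a set of
   equivalence classes (modulo P-null sets) is represented by a set of
   measurable functions that is [saturated], i.e. closed under P-a.e.
   equality. *)
Section L0defs.
Context {d : measure_display} {T : measurableType d} {R : realType}.

Definition L0 (X : T -> R) : Prop := measurable_fun setT X.

Definition L0p (P : probability T R) (X : T -> R) : Prop :=
  L0 X /\ {ae P, forall x, 0 <= X x}.

Definition aeeq (P : probability T R) (X Y : T -> R) : Prop :=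
  {ae P, forall x, X x = Y x}.

Definition saturated (P : probability T R) (S : set (T -> R)) : Prop :=
  forall X Y, S X -> L0 Y -> aeeq P X Y -> S Y.

Definition convex_fset (S : set (T -> R)) : Prop :=
  forall X Y (l : R), S X -> S Y -> 0 <= l <= 1 ->
    S (fun x => l * X x + (1 - l) * Y x).

Definition solid (P : probability T R) (S : set (T -> R)) : Prop :=
  forall X Y, S X -> L0p P Y -> {ae P, forall x, Y x <= X x} -> S Y.

Definition bounded_L0 (P : probability T R) (S : set (T -> R)) : Prop :=
  forall e : R, 0 < e -> exists N : nat, forall n : nat, (N <= n)%N ->
    forall X, S X -> (P [set x | (n%:R < `|X x|)%R] <= e%:E)%E.

Definition dL0 (P : probability T R) (X Y : T -> R) : R :=
  fine (\int[P]_x (Num.min 1 `|X x - Y x|)%:E).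

Definition dL1 (Q : probability T R) (X Y : T -> R) : R :=
  fine (\int[Q]_x (`|X x - Y x|)%:E).

Definition rel_nbhd (dist : (T -> R) -> (T -> R) -> R) (S : set (T -> R))
    (X : T -> R) (U : set (T -> R)) : Prop :=
  exists2 r : R, 0 < r & forall Y, S Y -> dist X Y < r -> U Y.

(* X has a neighbourhood base (relative to S, L^0 topology of P) of convex sets;
   neighbourhoods are subsets of S, viewed as sets of classes *)
Definition convex_nbhd_base (P : probability T R) (S : set (T -> R))
    (X : T -> R) : Prop :=
  forall U, rel_nbhd (dL0 P) S X U ->
    exists V : set (T -> R),
      [/\ V `<=` S, saturated P V, convex_fset V, rel_nbhd (dL0 P) S X V
        & V `<=` U].

Definition fwd_conv (Xs : nat -> T -> R) (n : nat) (Z : T -> R) : Prop :=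
  exists (m : nat) (w : nat -> R),
    [/\ forall k, 0 <= w k, \sum_(n <= k < m) w k = 1
      & forall x, Z x = \sum_(n <= k < m) w k * Xs k x].

Definition cvg0_L0 (P : probability T R) (Xs : nat -> T -> R) : Prop :=
  dL0 P (Xs n) (fun=> 0) @[n --> \oo] --> 0.

Definition equiv_prob (P Q : probability T R) : Prop :=
  forall A, measurable A -> (P A = 0 <-> Q A = 0).

Definition unif_integrable (Q : probability T R) (S : set (T -> R)) : Prop :=
  forall e : R, 0 < e -> exists N : nat, forall n : nat, (N <= n)%N ->
    forall X, S X ->
      (\int[Q]_(x in [set x | (n%:R < `|X x|)%R]) (`|X x|)%:E <= e%:E)%E.

End L0defs.

(* Main.v *)
Require Import Defs.
From HB Require Import structures.
From mathcomp Require Import all_boot all_order all_algebra.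
From mathcomp Require Import all_classical all_reals all_analysis.
From mathcomp Require Import measurable_realfun ring lra.
Import Order.TTheory GRing.Theory Num.Theory.
Import numFieldNormedType.Exports.
Local Open Scope classical_set_scope.
Local Open Scope ring_scope.

(* The crux is that a convex neighbourhood base at [0] yields uniform
   integrability. If [V] is a convex set of random variables with values in
   [0, M] such that [P (X > a) <= a] for all [X] in [V], let [Xh] in [V] almost
   maximize [E (min X (2 * a))]. Comparing [Xh] with [t * X + (1 - t) * Xh]
   for small [t] shows that [E (X; Xh <= a) <= 3 * a] for every [X] in [V], and
   [P (Xh > a) <= a].
   By boundedness and solidity there are levels [n_0 < n_1 < ...] such that
   all layers [X * 1{n_j < X <= n_(j+1)}] lie in a convex subset of the class
   that is this small with [a = 2^-(j+1)]. This yields events [A_j] with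
   [P (~ A_j) <= 2^-(j+1)] on which the [j]-th layers have expectation at most
   [3 * 2^-(j+1)], and a density that is a suitably weighted sum of the
   indicators of [B_m = A_m /\ A_(m+1) /\ ...] makes the sum of the layers
   beyond [n_k] uniformly small.
   Conversely, under uniform Q-integrability convergence in probability is
   convergence in L^1(Q), whose balls are convex. *)

(** * Convex sets of bounded random variables with small tail probabilities *)

Section ApproximateMaximizer.
Context {d : measure_display} {T : measurableType d} {R : realType}.
Implicit Types (P : probability T R) (X : T -> R).

Lemma integrable_bounded P X (C : R) : measurable_fun setT X ->
  (forall x, `|X x| <= C) -> P.-integrable setT (EFin \o X).
Proof.
move=> mX XC; apply: measurable_bounded_integrable => //.
  by apply: (le_lt_trans (probability_le1 P _)); rewrite ?ltry.
exists C; split; first exact: num_real.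
by move=> y Cy x _; apply: le_trans (XC x) (ltW Cy).
Qed.

(** Where [x <= a], the cap [2 * a] does not bind, because [t * z <= t * M <= a], and the increment
    is [t * (z - x)]. Where [x > a], concavity of the truncation and [0 <= z] limit the loss to
    [t * (2 * a)]. *)
Lemma min_convex_combination_increment (a x z t M : R) :
  0 <= x -> 0 <= z <= M -> 0 < t -> t <= 1 -> t * M <= a ->
  t * ((x <= a)%R%:R * z - 2 * a) <=
  Num.min (t * z + (1 - t) * x) (2 * a) - Num.min x (2 * a).
Proof.
move=> x0 /andP[z0 zM] t0 t1 tMa.
have a0 : 0 <= a by nra.
have [xa|xa] := leP x a; rewrite ?mul1r ?mul0r.
- rewrite [Num.min x _]min_l; last by lra.
  rewrite min_l; last by nra.
  by nra.
- have tz : 0 <= t * z by rewrite mulr_ge0// ltW.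
  have ta : 0 <= t * a by rewrite mulr_ge0// ltW.
  have [xa2|xa2] := leP x (2 * a);
    have [ya|ya] := leP (t * z + (1 - t) * x) (2 * a).
  + have : t * x <= t * (2 * a) by rewrite ler_pM2l.
    by nra.
  + by nra.
  + have : (1 - t) * (2 * a) <= (1 - t) * x by rewrite ler_wpM2l ?subr_ge0// ltW.
    by nra.
  + by nra.
Qed.

(* [Xh] almost maximizes the concave functional [E (min X (2 * a))] over [K];
   the first-order condition at [Xh] bounds [E X] on the set where [Xh <= a]. *)
Lemma convex_tail_integral_bound P (K : set (T -> R)) (a dl M : R) :
  0 < a -> 0 < M -> 0 <= dl -> convex_fset K ->
  (forall X, K X -> measurable_fun setT X /\ forall x, 0 <= X x <= M) ->
  (forall X, K X -> (P [set x | (a < X x)%R] <= dl%:E)%E) ->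
  exists A : set T, [/\ measurable A, (P (~` A) <= dl%:E)%E &
    forall X, K X -> (\int[P]_(x in A) (X x)%:E <= (3 * a)%:E)%E].
Proof.
move=> a0 M0 dl0 Kc Kb Ka.
have [->|/set0P[X0 KX0]] := eqVneq K set0.
  exists setT; split => //.
  by rewrite setCT measure0 lee_fin.
pose phi (u : R) := Num.min u (2 * a).
have phi0 X : K X -> forall x, 0 <= phi (X x) <= 2 * a.
  move=> /Kb[_ XM] x; have /andP[X0x _] := XM x.
  by rewrite /phi le_min X0x ge_min lexx orbT andbT mulr_ge0// ltW.
have mphi X : K X -> measurable_fun setT (phi \o X).
  by move=> /Kb[mX _]; exact: measurable_minr.
have iphi X : K X -> P.-integrable setT (EFin \o (phi \o X)).
  move=> KX; apply: (@integrable_bounded _ _ (2 * a)); first exact: mphi.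
  by move=> x /=; have /andP[? ?] := phi0 _ KX x; rewrite ger0_norm.
pose E := [set \int[P]_x phi (X x) | X in K].
have icst (c : R) : P.-integrable setT (EFin \o (fun=> c)).
  by apply: (@integrable_bounded _ _ `|c|).
have intc (c : R) : \int[P]_x c = c.
  rewrite Rintegral_cst// -[RHS]mulr1; congr (_ * _).
  exact: (congr1 fine (probability_setT P)).
have ubE : has_ubound E.
  exists (2 * a) => _ [X KX <-]; rewrite -[leRHS]intc; apply: le_Rintegral => //.
  - exact: iphi.
  - by move=> x _; have /andP[] := phi0 _ KX x.
have supE : has_sup E by split=> //; exists (\int[P]_x phi (X0 x)); exists X0.
(* The step size satisfies [t * M <= a]: moving from [Xh] towards any [X] in [K] adds at most
   [a]. *)
pose t := Num.min 1 (a / M).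
have t0 : 0 < t by rewrite /t lt_min ltr01 divr_gt0.
have t1 : t <= 1 by rewrite /t ge_min lexx.
have tMa : t * M <= a by rewrite -ler_pdivlMr// /t ge_min lexx orbT.
(* The allowed defect [t * a] is proportional to the step; after division by [t] it adds one [a] to
   the [2 * a] of the increment bound, whence [3 * a]. *)
have [_ [Xh KXh <-] supXh] := sup_adherent (mulr_gt0 t0 a0) supE.
have [mXh XhM] := Kb _ KXh.
have mA : measurable [set x | Xh x <= a].
  rewrite -[X in measurable X]setTI.
  by apply: measurable_fun_le.
exists [set x | Xh x <= a]; split => //.
  have -> : ~` [set x | Xh x <= a] = [set x | a < Xh x].
    by apply/seteqP; split => x /=; rewrite ltNge => /negP.
  exact: Ka.
move=> X KX; have [mX XM] := Kb _ KX.
pose Y := fun x => t * X x + (1 - t) * Xh x.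
have KY : K Y by apply: Kc => //; rewrite t1 ltW.
pose XA x := (Xh x <= a)%R%:R * X x : R.
have XAE : XA = X \_ [set x | Xh x <= a].
  apply/funext => x; rewrite patchE /XA.
  have [xa|xa] := boolP (Xh x <= a); first by rewrite mem_set// mul1r.
  by rewrite memNset ?mul0r//; exact/negP.
have iXA : P.-integrable setT (EFin \o XA).
  apply: (@integrable_bounded _ _ M) => [|x].
    rewrite XAE; apply/(measurable_restrictT _ mA).
    exact: measurable_funTS.
  have /andP[X0x XMx] := XM x.
  rewrite /XA; case: (Xh x <= a); rewrite ?mul1r ?mul0r ?normr0 ?(ltW M0)//.
  by rewrite ger0_norm.
have iXA2 : P.-integrable setT (EFin \o (fun x => XA x - 2 * a)).
  exact: (integrableB measurableT iXA (icst (2 * a))).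
have iL : P.-integrable setT (EFin \o (fun x => t * (XA x - 2 * a))).
  exact: (integrableZl measurableT t iXA2).
have := @le_Rintegral _ _ _ P setT _ _ measurableT iL
  (integrableB measurableT (iphi _ KY) (iphi _ KXh)).
have -> : \int[P]_x (phi (Y x) - phi (Xh x)) =
    \int[P]_x phi (Y x) - \int[P]_x phi (Xh x).
  exact: (RintegralB measurableT (iphi _ KY) (iphi _ KXh)).
rewrite RintegralZl// RintegralB// intc.
have YE : \int[P]_x phi (Y x) <= sup E by apply: ub_le_sup => //; exists Y.
move=> /(_ (fun x _ => min_convex_combination_increment _ _ _ _ _
  (proj1 (andP (XhM x))) (XM x) t0 t1 tMa)) H.
have {}H : \int[P]_x XA x <= 3 * a by rewrite -(ler_pM2l t0); lra.
rewrite integral_mkcond (_ : _ \_ _ = EFin \o XA); last first.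
  by rewrite XAE; apply/funext => x; rewrite !patchE /= !patchE; case: ifP.
by rewrite -[leLHS]fineK ?lee_fin//; exact: integrable_fin_num.
Qed.

End ApproximateMaximizer.

(** * Markov's inequality and splitting an integral at a level *)

Section TailIntegrals.
Context {d : measure_display} {T : measurableType d} {R : realType}.
Context (mu : {measure set T -> \bar R}).
Implicit Types (f X Y : T -> R) (c : R).

Lemma measurable_gt_set f c : measurable_fun setT f ->
  measurable [set x | c < f x].
Proof.
move=> mf; have -> : [set x | c < f x] = ~` [set x | f x <= c].
  by apply/seteqP; split => x /=; rewrite ltNge => /negP.
apply: measurableC; rewrite -[X in measurable X]setTI.
exact: measurable_fun_le.
Qed.

Lemma measurable_dist X Y : measurable_fun setT X -> measurable_fun setT Y ->
  measurable_fun setT (fun x => `|X x - Y x|).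
Proof. by move=> mX mY; apply: measurableT_comp => //; exact: measurable_funB. Qed.

Lemma measurable_truncated_dist X Y : measurable_fun setT X ->
  measurable_fun setT Y -> measurable_fun setT (fun x => Num.min 1 `|X x - Y x|).
Proof. by move=> mX mY; apply: measurable_minr => //; exact: measurable_dist. Qed.

Lemma markov_tail f c : measurable_fun setT f -> (forall x, 0 <= f x) -> 0 <= c ->
  (c%:E * mu [set x | (c < f x)%R] <= \int[mu]_x (f x)%:E)%E.
Proof.
move=> mf f0 c0; have mA := measurable_gt_set _ c mf.
rewrite -integral_cst//.
apply: (@le_trans _ _ (\int[mu]_(x in [set x | (c < f x)%R]) (f x)%:E)%E).
  apply: ge0_le_integral => //=.
  - by apply/measurable_EFinP; exact: measurable_funTS.
  - by move=> x /ltW; rewrite lee_fin.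
apply: ge0_subset_integral => //; first exact/measurable_EFinP.
by move=> x _; rewrite lee_fin.
Qed.

(** Pointwise, [f] is at most [c] plus [f] times the indicator of [c < f]. *)
Lemma integral_le_tail f (A : set T) c : measurable A -> measurable_fun setT f ->
  (forall x, 0 <= f x) -> 0 <= c ->
  (\int[mu]_(x in A) (f x)%:E <=
   c%:E * mu A + \int[mu]_(x in [set x | (c < f x)%R]) (f x)%:E)%E.
Proof.
move=> mA mf f0 c0; have mB := measurable_gt_set _ c mf.
pose g := (EFin \o f) \_ [set x | c < f x].
have mg : measurable_fun setT g.
  apply/(measurable_restrictT _ mB)/measurable_funTS; exact/measurable_EFinP.
have g0 x : (0 <= g x)%E by rewrite /g patchE; case: ifP => //; rewrite lee_fin.
rewrite -integral_cst// (integral_mkcond [set x | (c < f x)%R]) -/g.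
apply: (@le_trans _ _ (\int[mu]_(x in A) (c%:E + g x))%E).
  apply: ge0_le_integral => //.
  - by move=> x _; rewrite lee_fin.
  - by apply/measurable_EFinP; exact: measurable_funTS.
  - by apply: emeasurable_funD => //; exact: measurable_funTS.
  move=> x _; rewrite /g patchE; case: ifPn => [_|].
    by rewrite -EFinD lee_fin lerDr.
  by move=> /negP; rewrite inE/= => /negP; rewrite -leNgt adde0 lee_fin.
rewrite ge0_integralD//; last exact: measurable_funTS.
by apply: leeD => //; apply: ge0_subset_integral.
Qed.

End TailIntegrals.

(** * The metrics of convergence in probability and of [L^1] *)

Section L0Metric.
Context {d : measure_display} {T : measurableType d} {R : realType}.
Implicit Types (P Q : probability T R) (X Y : T -> R).

Lemma dL0E P X Y : measurable_fun setT X -> measurable_fun setT Y ->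
  (dL0 P X Y)%:E = (\int[P]_x (Num.min 1 `|X x - Y x|)%:E)%E.
Proof.
move=> mX mY; rewrite fineK//; apply: integrable_fin_num => //.
apply: (@integrable_bounded _ _ _ _ _ 1); first exact: measurable_truncated_dist.
by move=> x; rewrite ger0_norm ?le_min ?ler01 ?normr_ge0// ge_min lexx.
Qed.

Lemma dL0C P X Y : dL0 P X Y = dL0 P Y X.
Proof. by congr fine; apply: eq_integral => x _; rewrite distrC. Qed.

Lemma dL0_ge0 P X Y : 0 <= dL0 P X Y.
Proof.
apply: fine_ge0; apply: integral_ge0 => x _.
by rewrite lee_fin le_min ler01 normr_ge0.
Qed.

(** Since [c < 1], truncating the distance at 1 does not change the event that it exceeds [c]. *)
Lemma dL0_markov P X Y c : measurable_fun setT X -> measurable_fun setT Y ->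
  0 <= c < 1 -> (c%:E * P [set x | (c < `|X x - Y x|)%R] <= (dL0 P X Y)%:E)%E.
Proof.
move=> mX mY /andP[c0 c1]; rewrite dL0E//.
have -> : [set x | c < `|X x - Y x|] = [set x | c < Num.min 1 `|X x - Y x|].
  by apply/seteqP; split => x /=; rewrite lt_min c1.
by apply: (markov_tail P) => //; exact: measurable_truncated_dist.
Qed.

Lemma dL0_le_tail P X Y c : measurable_fun setT X -> measurable_fun setT Y ->
  0 <= c -> ((dL0 P X Y)%:E <= c%:E + P [set x | (c < `|X x - Y x|)%R])%E.
Proof.
move=> mX mY c0; rewrite dL0E//.
have mm := measurable_truncated_dist _ _ mX mY.
have m0 x : 0 <= Num.min 1 `|X x - Y x| by rewrite le_min ler01 normr_ge0.
have mA := measurable_gt_set _ c mm.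
have mB := measurable_gt_set _ c (measurable_dist _ _ mX mY).
apply: le_trans (integral_le_tail P _ _ c measurableT mm m0 c0) _.
apply: leeD.
  by rewrite -[leRHS]mule1 lee_wpmul2l ?lee_fin//; exact: probability_le1.
apply: (@le_trans _ _ (P [set x | (c < Num.min 1 `|X x - Y x|)%R])).
  rewrite -[leRHS]mul1e -integral_cst//; apply: ge0_le_integral => //.
  - by apply/measurable_EFinP; exact: measurable_funTS.
  - by move=> x _; rewrite lee_fin ge_min lexx.
apply: le_measure; rewrite ?inE//.
by move=> x /=; rewrite lt_min => /andP[].
Qed.

Lemma ae_equiv P Q (p : T -> Prop) : equiv_prob P Q ->
  {ae P, forall x, p x} -> {ae Q, forall x, p x}.
Proof. by move=> PQ [A [mA A0 pA]]; exists A; split => //; apply/PQ. Qed.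

Lemma dL0_aeeq P X Y Y' : measurable_fun setT X -> measurable_fun setT Y ->
  measurable_fun setT Y' -> aeeq P Y Y' -> dL0 P X Y = dL0 P X Y'.
Proof.
move=> mX mY mY' YY'; congr fine.
apply: ae_eq_integral => //.
- by apply/measurable_EFinP; exact: measurable_truncated_dist.
- by apply/measurable_EFinP; exact: measurable_truncated_dist.
by apply: filterS YY' => x /= -> _.
Qed.

Lemma dL1_aeeq P X Y Y' : measurable_fun setT X -> measurable_fun setT Y ->
  measurable_fun setT Y' -> aeeq P Y Y' -> dL1 P X Y = dL1 P X Y'.
Proof.
move=> mX mY mY' YY'; congr fine.
apply: ae_eq_integral => //.
- by apply/measurable_EFinP; exact: measurable_dist.
- by apply/measurable_EFinP; exact: measurable_dist.
by apply: filterS YY' => x /= -> _.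
Qed.

Lemma dL1E P X Y : P.-integrable setT (EFin \o X) -> P.-integrable setT (EFin \o Y) ->
  (dL1 P X Y)%:E = (\int[P]_x `|X x - Y x|%:E)%E.
Proof.
move=> iX iY; rewrite fineK//; apply: integrable_fin_num => //.
exact: (integrable_abse (integrableB measurableT iX iY)).
Qed.

Lemma dL1_convex P X Y Z l : P.-integrable setT (EFin \o X) ->
  P.-integrable setT (EFin \o Y) -> P.-integrable setT (EFin \o Z) ->
  0 <= l <= 1 ->
  dL1 P X (fun x => l * Y x + (1 - l) * Z x) <= l * dL1 P X Y + (1 - l) * dL1 P X Z.
Proof.
move=> iX iY iZ /andP[l0 l1]; have l1' : 0 <= 1 - l by rewrite subr_ge0.
have iYZ : P.-integrable setT (EFin \o (fun x => l * Y x + (1 - l) * Z x)).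
  exact: (integrableD measurableT (integrableZl measurableT l iY)
    (integrableZl measurableT (1 - l) iZ)).
have iXY := integrable_abse (integrableB measurableT iX iY).
have iXZ := integrable_abse (integrableB measurableT iX iZ).
rewrite -lee_fin EFinD !EFinM !dL1E//.
rewrite -!integralZl// -integralD//; [|exact: integrableZl..].
apply: le_integral => //.
- exact: (integrable_abse (integrableB measurableT iX iYZ)).
- by apply: integrableD => //; exact: integrableZl.
move=> x _; rewrite lee_fin.
have -> : X x - (l * Y x + (1 - l) * Z x) =
  l * (X x - Y x) + (1 - l) * (X x - Z x) by ring.
by apply: le_trans (ler_normD _ _) _; rewrite !normrM (ger0_norm l0) (ger0_norm l1').
Qed.

End L0Metric.

(** * Convex combinations of finite families and the convex hull of a ball *)

Section ConvexCombinations.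
Context {d : measure_display} {T : measurableType d} {R : realType}.
Implicit Types (P : probability T R) (S : set (T -> R)).

(** The total weight is left free and divided out, so that the induction can pass to the tail of the
    list, whose weights need not sum to 1. A tail of weight zero leaves only the head. *)
Lemma convex_fset_normalized_sum S (s : seq nat) (w : nat -> R) (X : nat -> T -> R) :
  convex_fset S -> (forall k, 0 <= w k) -> (forall k, k \in s -> S (X k)) ->
  0 < \sum_(k <- s) w k ->
  S (fun x => (\sum_(k <- s) w k)^-1 * \sum_(k <- s) w k * X k x).
Proof.
move=> Sc w0; elim: s => [|k s IH] SX; first by rewrite big_nil ltxx.
have SXs i : i \in s -> S (X i) by move=> si; apply: SX; rewrite inE si orbT.
have SXk : S (X k) by apply: SX; rewrite mem_head.
have Ws0 : 0 <= \sum_(i <- s) w i by exact: sumr_ge0.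
move: Ws0; rewrite le_eqVlt => /predU1P[Ws0|Ws0].
  have wi0 i : i \in s -> w i = 0.
    move=> si; apply/eqP; have /esym/eqP := Ws0.
    by rewrite psumr_eq0// => /allP/(_ _ si).
  rewrite big_cons -Ws0 addr0 => wk0; apply: (eq_ind (X k) S SXk).
  apply/funext => x; rewrite big_cons big1_seq ?addr0; last first.
    by move=> i /andP[_ si]; rewrite wi0// mul0r.
  by rewrite mulKf// gt_eqF.
rewrite big_cons; set W := \sum_(i <- s) w i in Ws0 IH * => wW0.
pose l := w k / (w k + W).
have l01 : 0 <= l <= 1.
  by rewrite /l divr_ge0 ?(ltW wW0)//= ler_pdivrMr// mul1r lerDl ltW.
apply: (eq_ind _ S (Sc _ _ l SXk (IH SXs Ws0) l01)).
apply/funext => x; rewrite big_cons /l.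
by field; rewrite !gt_eqF.
Qed.

Lemma convex_fset_fwd_conv S (Xs : nat -> T -> R) n Z : convex_fset S ->
  (forall k, (n <= k)%N -> S (Xs k)) -> fwd_conv Xs n Z -> S Z.
Proof.
move=> Sc SX [m [w [w0 w1 ZE]]].
have /(_ _)/= := @convex_fset_normalized_sum S (index_iota n m) w Xs Sc w0.
rewrite w1 => H; apply: (eq_ind _ S (H _ ltr01)).
  by move=> k; rewrite mem_index_iota => /andP[/SX].
by apply/funext => x; rewrite invr1 mul1r ZE.
Qed.

(** The convex hull of the ball of radius [r] around 0 in [S], modulo null sets; almost everywhere
    equality makes it saturated when [S] is. *)
Definition ball_hull P S (r : R) : set (T -> R) :=
  [set Z | S Z /\ exists (m : nat) (w : nat -> R) (X : nat -> T -> R),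
    [/\ forall k, 0 <= w k, \sum_(k < m) w k = 1,
        forall k, S (X k) /\ dL0 P (X k) (fun=> 0) < r
      & aeeq P Z (fun x => \sum_(k < m) w k * X k x)]].

Lemma saturated_ball_hull P S r : saturated P S -> saturated P (ball_hull P S r).
Proof.
move=> Ss Z Z' [SZ [m [w [X [w0 w1 SX ZE]]]]] mZ' ZZ'; split.
  exact: Ss ZZ'.
exists m, w, X; split => //.
by apply: filterS2 ZE ZZ' => x <- ->.
Qed.

Lemma convex_ball_hull P S r : convex_fset S -> convex_fset (ball_hull P S r).
Proof.
move=> Sc Y Z l [SY [m1 [w1 [X1 [w10 w11 SX1 YE]]]]].
move=> [SZ [m2 [w2 [X2 [w20 w21 SX2 ZE]]]]] /[dup] l01 /andP[l0 l1].
split; first exact: Sc.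
(* The two combinations are concatenated, with weights scaled by [l] and [1 - l]. *)
pose w k := if (k < m1)%N then l * w1 k else (1 - l) * w2 (k - m1)%N.
pose X k := if (k < m1)%N then X1 k else X2 (k - m1)%N.
have wl (i : 'I_m1) : w (lshift m2 i) = l * w1 i by rewrite /w /= ltn_ord.
have wr (i : 'I_m2) : w (rshift m1 i) = (1 - l) * w2 i.
  by rewrite /w /= ltnNge leq_addr/= addKn.
have Xl (i : 'I_m1) : X (lshift m2 i) = X1 i by rewrite /X /= ltn_ord.
have Xr (i : 'I_m2) : X (rshift m1 i) = X2 i.
  by rewrite /X /= ltnNge leq_addr/= addKn.
exists (m1 + m2)%N, w, X; split.
- by move=> k; rewrite /w; case: ifP => _; rewrite mulr_ge0// subr_ge0.
- rewrite big_split_ord/= (eq_bigr _ (fun i _ => wl i)).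
  rewrite (eq_bigr _ (fun i _ => wr i)) -!mulr_sumr w11 w21; ring.
- by move=> k; rewrite /X; case: ifP.
- apply: filterS2 YE ZE => x -> ->.
  rewrite big_split_ord/= !mulr_sumr; congr (_ + _); apply: eq_bigr => i _.
  + by rewrite wl Xl mulrA.
  + by rewrite wr Xr mulrA.
Qed.

End ConvexCombinations.

(* Enumerates consecutive blocks of lengths [m 0], [m 1], ...: position [j]
   is the [i]-th place of the [n]-th block when [block m j = (n, i)]. *)
Fixpoint block (m : nat -> nat) (j : nat) : nat * nat :=
  if j is j'.+1 then
    let: (n, i) := block m j' in if (i.+1 < m n)%N then (n, i.+1) else (n.+1, 0%N)
  else (0%N, 0%N).

(** Lengths must be positive because [block] spends at least one position on every block, even when
    [m n = 0]. *)
Lemma block_offset m n i : (forall n, (0 < m n)%N) -> (i < m n)%N ->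
  block m (\sum_(k < n) m k + i) = (n, i).
Proof.
move=> m0; elim: n i => [|n IHn]; elim=> [|i IHi] im.
- by rewrite big_ord0.
- by rewrite addnS/= IHi ?im// ltnW.
- rewrite big_ord_recr/= addn0 -(prednK (m0 n)) addnS/= IHn ?prednK//.
  by rewrite ltnn.
- by rewrite addnS/= IHi ?im// ltnW.
Qed.

Lemma block_mono m j j' : (j <= j')%N -> ((block m j).1 <= (block m j').1)%N.
Proof.
move=> /subnK <-; elim: (j' - j)%N => [//|k IH]; rewrite addSn/=.
apply: leq_trans IH _; case: (block m _) => n i.
by case: ifP => _ //=; exact: leqnSn.
Qed.

(** * Forward convex combinations and convex neighbourhoods of 0 *)

Section ForwardConvex.
Context {d : measure_display} {T : measurableType d} {R : realType}.
Context (P : probability T R) (X_ : set (T -> R)).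
Context (hX0 : X_ `<=` L0p P) (hsat : saturated P X_).

Lemma cvg0_L0P (Xs : nat -> T -> R) : cvg0_L0 P Xs <->
  forall e : R, 0 < e -> exists N, forall n, (N <= n)%N -> dL0 P (Xs n) (fun=> 0) < e.
Proof.
split=> [/cvgrPdist_lt H e e0|H].
  have [N _ HN] := H _ e0; exists N => n Nn.
  by have := HN n Nn; rewrite sub0r normrN ger0_norm// dL0_ge0.
apply/cvgrPdist_lt => e e0; have [N HN] := H _ e0.
exists N => // n Nn /=.
by rewrite sub0r normrN ger0_norm ?dL0_ge0//; exact: HN.
Qed.

(** A convex neighbourhood of 0 contains a tail of the sequence, hence all convex combinations of
    that tail. *)
Lemma convex_nbhd_base0_fwd_conv : convex_nbhd_base P X_ (fun=> 0) ->
  forall Xs : nat -> T -> R, (forall n, X_ (Xs n)) -> cvg0_L0 P Xs ->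
  forall Ys : nat -> T -> R, (forall n, fwd_conv Xs n (Ys n)) -> cvg0_L0 P Ys.
Proof.
move=> base Xs XXs /cvg0_L0P Xs0 Ys YsE; apply/cvg0_L0P => e e0.
have [|V [VX _ Vc [r r0 rV] VU]] := base [set Y | dL0 P Y (fun=> 0) < e].
  by exists e => // Y _; rewrite dL0C.
have [N HN] := Xs0 _ r0; exists N => n Nn.
apply: VU; apply: convex_fset_fwd_conv (YsE n) => // k nk.
by apply: rV => //; rewrite dL0C; apply: HN; exact: leq_trans nk.
Qed.

(** If no convex neighbourhood fits into [U], the hull of every ball around 0 has a point outside
    [U], hence at distance at least [r]. Concatenating the finite families that represent such
    points for the radii [1 / (n + 1)] gives a sequence converging to 0 with forward convex
    combinations that stay away from 0. *)
Lemma fwd_conv_convex_nbhd_base0 (hconv : convex_fset X_) :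
  (forall Xs : nat -> T -> R, (forall n, X_ (Xs n)) -> cvg0_L0 P Xs ->
   forall Ys : nat -> T -> R, (forall n, fwd_conv Xs n (Ys n)) -> cvg0_L0 P Ys) ->
  convex_nbhd_base P X_ (fun=> 0).
Proof.
move=> fwd U [r r0 rU]; apply: contrapT => nV.
have bad (n : nat) : exists q : nat * (nat -> R) * (nat -> T -> R),
    [/\ forall k, 0 <= q.1.2 k, \sum_(k < q.1.1) q.1.2 k = 1,
      forall k, X_ (q.2 k) /\ dL0 P (q.2 k) (fun=> 0) < n.+1%:R^-1
    & r <= dL0 P (fun x => \sum_(k < q.1.1) q.1.2 k * q.2 k x) (fun=> 0)].
  apply: contrapT => nq; apply: nV; exists (ball_hull P X_ n.+1%:R^-1); split.
  - by move=> Z [].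
  - exact: saturated_ball_hull.
  - exact: convex_ball_hull.
  - exists n.+1%:R^-1; first by rewrite invr_gt0.
    move=> Y XY Yn; split => //.
    exists 1%N, (fun=> 1), (fun=> Y); split => //.
    + by rewrite big_ord1.
    + by rewrite dL0C.
    + by apply: aeW => x; rewrite big_ord1 mul1r.
  - move=> Z [XZ [m [w [X [w0 w1 XX ZE]]]]]; apply: rU => //.
    rewrite ltNge; apply/negP => rZ; apply: nq; exists (m, w, X); split => //=.
    rewrite dL0C -(@dL0_aeeq _ _ _ _ _ Z)//.
    + by case: (hX0 _ XZ).
    + apply: measurable_sum => k; apply: measurable_funM => //.
      by have [/hX0[]] := XX k.
have [q qP] := choice bad.
pose m n := (q n).1.1; pose w n := (q n).1.2; pose X n := (q n).2.
have m0 n : (0 < m n)%N.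
  have [_ + _ _] := qP n; rewrite -/(m n) lt0n; apply: contra_eqN => /eqP ->.
  by rewrite big_ord0 eq_sym oner_eq0.
pose S n := (\sum_(k < n) m k)%N.
(* Block [n] begins at position [S n >= n], so a combination of its points is forward from [n]. *)
have nS n : (n <= S n)%N.
  elim: n => // n IH; rewrite /S big_ord_recr/= -addn1.
  exact: leq_add.
pose Xs j := X (block m j).1 (block m j).2.
pose Ys n x := \sum_(k < m n) w n k * X n k x.
have Xs0 : cvg0_L0 P Xs.
  apply/cvg0_L0P => e e0.
  have [N NE] : exists N : nat, N.+1%:R^-1 < e.
    have [N _ /(_ N (leqnn N)) ?] := near_infty_natSinv_lt (PosNum e0).
    by exists N.
  exists (S N) => j Nj.
  have Nb : (N <= (block m j).1)%N.
    by have := block_mono m _ _ Nj; rewrite -[S N]addn0 block_offset.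
  have [_ _ /(_ (block m j).2)[_ h] _] := qP (block m j).1.
  apply: lt_trans NE; apply: lt_le_trans h _.
  by rewrite lef_pV2 ?posrE// ler_nat.
have Ysfwd n : fwd_conv Xs n (Ys n).
  (* The weights of block [n], moved to its positions and preceded by zeros. *)
  pose v j := if (S n <= j)%N then w n (j - S n)%N else 0.
  have sumv (F : nat -> R) : \sum_(n <= j < m n + S n) v j * F j =
      \sum_(k < m n) w n k * F (k + S n)%N.
    rewrite (big_cat_nat (nS n)) ?leq_addl//= big_nat_cond big1 ?add0r.
      rewrite -{1}[S n]add0n big_addn addnK big_mkord.
      by apply: eq_bigr => k _; rewrite /v leq_addl addnK.
    by move=> j /andP[/andP[_ jS] _]; rewrite /v leqNgt jS mul0r.
  have [w0 w1 _ _] := qP n.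
  exists (m n + S n)%N, v; split.
  - by move=> k; rewrite /v; case: ifP => // _; exact: w0.
  - transitivity (\sum_(n <= j < m n + S n) v j * 1).
      by apply: eq_bigr => j _; rewrite mulr1.
    by rewrite (sumv (fun=> 1)) -[RHS]w1; apply: eq_bigr => j _; rewrite mulr1.
  - move=> x; rewrite (sumv (Xs ^~ x)); apply: eq_bigr => k _.
    by rewrite /Xs addnC block_offset.
have XXs j : X_ (Xs j) by have [_ _ /(_ (block m j).2)[]] := qP (block m j).1.
have /cvg0_L0P/(_ _ r0)[N /(_ _ (leqnn N))] := fwd _ XXs Xs0 _ Ysfwd.
by apply/negP; rewrite -leNgt; have [] := qP N.
Qed.

End ForwardConvex.

(** * Comparison of distances under equivalent probabilities *)

Section EquivalentProbability.
Context {d : measure_display} {T : measurableType d} {R : realType}.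
Implicit Types (P Q : probability T R) (X Y : T -> R).

Lemma equiv_prob_sym P Q : equiv_prob P Q -> equiv_prob Q P.
Proof. by move=> PQ A mA; apply: iff_sym; exact: PQ. Qed.

(** Otherwise there are events of [P]-probability at most [2^-(n+1)] and [Q]-probability above [e].
    By Borel-Cantelli their limit superior is [P]-null, hence [Q]-null, whereas continuity from
    above gives it [Q]-probability at least [e]. *)
Lemma equiv_prob_uniformly P Q (e : R) : equiv_prob P Q -> 0 < e ->
  exists2 dl : R, 0 < dl &
    forall A, measurable A -> (P A <= dl%:E -> Q A <= e%:E)%E.
Proof.
move=> PQ e0; apply: contrapT => nd.
have bad n : exists A, [/\ measurable A, (P A <= (1 / (2 ^ n.+1)%:R : R)%:E)%E
    & (e%:E < Q A)%E].
  apply: contrapT => nA; apply: nd; exists (1 / (2 ^ n.+1)%:R).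
    by rewrite divr_gt0// ltr0n expn_gt0.
  move=> A mA PA; rewrite leNgt; apply/negP => QA.
  by apply: nA; exists A.
have [A AP] := choice bad.
have mA n : measurable (A n) by have [] := AP n.
have mL : measurable (lim_sup_set A).
  by apply: bigcap_measurable => // n _; apply: bigcup_measurable.
have PL : P (lim_sup_set A) = 0.
  apply: lim_sup_set_cvg0 => //.
  apply: (@le_lt_trans _ _ 1%E); last exact: ltry.
  apply: le_trans (epsilon_trick0 xpredT (ler01 : 0 <= 1 :> R)).
  apply: lee_nneseries => [n _ _|n _]; first exact: measure_ge0.
  by have [] := AP n.
have QL : Q (lim_sup_set A) = 0 by apply/PQ.
have cvgQ : Q (\bigcup_(k in [set k | (n <= k)%N]) A k) @[n --> \oo] -->
    Q (lim_sup_set A).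
  apply: lim_sup_set_cvg => //; apply: le_lt_trans (probability_le1 Q _) (ltry _).
  exact: bigcup_measurable.
rewrite QL in cvgQ.
suff : (e%:E <= 0)%E by rewrite lee_fin leNgt e0.
rewrite -(cvg_lim _ cvgQ)//; apply: lime_ge; first by apply/cvg_ex; exists 0%E.
apply: nearW => n; have [_ _ /ltW QA] := AP n.
apply: le_trans QA _; apply: le_measure; rewrite ?inE//.
  exact: bigcup_measurable.
by move=> x Anx; exists n => /=.
Qed.

Lemma unif_integrable_integrable Q (S : set (T -> R)) X :
  unif_integrable Q S -> S X -> measurable_fun setT X ->
  Q.-integrable setT (EFin \o X).
Proof.
move=> ui SX mX; have [N /(_ N (leqnn N) X SX) HN] := ui _ ltr01.
apply/integrableP; split; first exact/measurable_EFinP.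
have mnX : measurable_fun setT (fun x => `|X x|) by exact: measurableT_comp.
apply: le_lt_trans (integral_le_tail Q _ _ N%:R measurableT mnX _ _) _ => //.
apply: (@le_lt_trans _ _ (N%:R%:E * 1 + 1)%E); last by rewrite mule1 -EFinD ltry.
apply: leeD HN; apply: lee_wpmul2l; first by rewrite lee_fin.
exact: probability_le1.
Qed.

(** A small [dL0] makes the event that [|X - Y|] exceeds [c] improbable under [P], hence under [Q].
    On it uniform integrability controls [|X| + |Y|]; off it the integrand is at most [c]. *)
Lemma unif_integrable_dL1_lt P Q (S : set (T -> R)) (r : R) :
  equiv_prob P Q -> unif_integrable Q S -> (forall X, S X -> measurable_fun setT X) ->
  0 < r -> exists2 r' : R, 0 < r' &
    forall X Y, S X -> S Y -> dL0 P X Y < r' -> dL1 Q X Y < r.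
Proof.
(* The final bound is [c + 4 * e <= 5 * e < r], with [2 * e] for each of [X] and [Y] on the event
   [B]. *)
move=> PQ ui mS r0; pose e := r / 8.
have e0 : 0 < e by rewrite divr_gt0.
have [N uiN] := ui _ e0.
have N0 : 0 < N.+1%:R :> R by [].
(* On an event of [Q]-probability at most [e / (N + 1)], the level [N] contributes at most [e]. *)
have [dl dl0 PQdl] := equiv_prob_uniformly _ _ _ PQ (divr_gt0 e0 N0).
pose c := Num.min e 2^-1.
have c0 : 0 < c by rewrite lt_min e0 invr_gt0 ltr0n.
have c1 : c < 1 by rewrite gt_min; apply/orP; right; rewrite invf_lt1// ltr1n.
have ce : c <= e by rewrite ge_min lexx.
exists (c * dl); first exact: mulr_gt0.
move=> X Y SX SY XYdl; have [mX mY] := (mS _ SX, mS _ SY).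
pose B := [set x | c < `|X x - Y x|].
have mB : measurable B := measurable_gt_set _ c (measurable_dist _ _ mX mY).
have PB : (P B <= dl%:E)%E.
  have := dL0_markov P X Y c mX mY.
  rewrite (ltW c0) c1 => /(_ isT) h.
  rewrite -(@lee_pmul2l _ c%:E)// ?lte_fin// -EFinM.
  by apply: le_trans h _; rewrite lee_fin ltW.
have QB := PQdl B mB PB.
have tail Z : S Z -> (\int[Q]_(x in B) (`|Z x|)%:E <= (e + e)%:E)%E.
  move=> SZ; have mnZ : measurable_fun setT (fun x => `|Z x|).
    by apply: measurableT_comp => //; exact: mS.
  apply: le_trans (integral_le_tail Q _ _ N%:R mB mnZ _ _) _ => //.
  rewrite EFinD; apply: leeD; last exact: uiN.
  apply: (@le_trans _ _ (N%:R%:E * (e / N.+1%:R)%:E)%E).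
    by apply: lee_wpmul2l; rewrite ?lee_fin.
  rewrite -EFinM lee_fin mulrCA ger_pMr// ler_pdivrMr// mul1r ler_nat.
  exact: leqnSn.
have iX := unif_integrable_integrable _ _ _ ui SX mX.
have iY := unif_integrable_integrable _ _ _ ui SY mY.
rewrite -lte_fin dL1E//.
have dist0 x : 0 <= `|X x - Y x| by [].
apply: le_lt_trans
  (integral_le_tail Q _ _ c measurableT (measurable_dist _ _ mX mY) dist0 (ltW c0)) _.
apply: (@le_lt_trans _ _ (c%:E * 1 + ((e + e)%:E + (e + e)%:E))%E); last first.
  by rewrite mule1 -!EFinD lte_fin /e in ce *; lra.
apply: leeD.
  by apply: lee_wpmul2l; [rewrite lee_fin ltW|exact: probability_le1].
have mEn Z : S Z -> measurable_fun B (fun x => (`|Z x|)%:E).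
  move=> SZ; apply/measurable_EFinP; apply: measurable_funTS.
  by apply: measurableT_comp => //; exact: mS.
apply: (@le_trans _ _ (\int[Q]_(x in B) (`|X x|%:E + `|Y x|%:E))%E).
  apply: ge0_le_integral => //.
  - by apply/measurable_EFinP; apply: measurable_funTS; exact: measurable_dist.
  - by apply: emeasurable_funD; exact: mEn.
  - by move=> x _; rewrite -EFinD lee_fin ler_normB.
rewrite ge0_integralD//; [|exact: mEn..].
by apply: leeD; exact: tail.
Qed.

(** Markov's inequality bounds the [Q]-probability, hence the [P]-probability, that the distance
    exceeds [c = r / 3]; then [dL0 P X Y <= 2 * c < r]. *)
Lemma equiv_prob_dL0_lt P Q (r : R) : equiv_prob P Q -> 0 < r ->
  exists2 r' : R, 0 < r' & forall X Y, Q.-integrable setT (EFin \o X) ->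
    Q.-integrable setT (EFin \o Y) -> dL1 Q X Y < r' -> dL0 P X Y < r.
Proof.
move=> PQ r0; pose c := r / 3.
have c0 : 0 < c by rewrite divr_gt0.
have [dl dl0 QPdl] := equiv_prob_uniformly _ _ _ (equiv_prob_sym _ _ PQ) c0.
exists (c * dl); first exact: mulr_gt0.
move=> X Y iX iY XYdl.
have mX : measurable_fun setT X by apply/measurable_EFinP; exact: measurable_int iX.
have mY : measurable_fun setT Y by apply/measurable_EFinP; exact: measurable_int iY.
have mD := measurable_dist _ _ mX mY.
pose B := [set x | c < `|X x - Y x|].
have mB : measurable B := measurable_gt_set _ c mD.
have QB : (Q B <= dl%:E)%E.
  rewrite -(@lee_pmul2l _ c%:E)// ?lte_fin// -EFinM.
  apply: le_trans (markov_tail Q _ c mD _ (ltW c0)) _ => //.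
  by rewrite -dL1E// lee_fin ltW.
rewrite -lte_fin; apply: le_lt_trans (dL0_le_tail _ _ _ _ mX mY (ltW c0)) _.
apply: (@le_lt_trans _ _ (c%:E + c%:E)%E); first by apply: leeD => //; exact: QPdl.
by rewrite -EFinD lte_fin /c; lra.
Qed.

End EquivalentProbability.

(** * Coincidence of the two topologies and convex neighbourhoods *)

Section NeighbourhoodBases.
Context {d : measure_display} {T : measurableType d} {R : realType}.
Context (P : probability T R) (X_ : set (T -> R)).
Context (hX0 : X_ `<=` L0p P) (hsat : saturated P X_).

Lemma unif_integrable_dL1_topology (Q : probability T R) :
  equiv_prob P Q -> unif_integrable Q X_ ->
  (forall X, X_ X -> Q.-integrable setT (EFin \o X)) /\
  forall X U, X_ X -> (rel_nbhd (dL0 P) X_ X U <-> rel_nbhd (dL1 Q) X_ X U).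
Proof.
move=> PQ ui; have mX_ X : X_ X -> measurable_fun setT X by move=> /hX0[].
have iX_ X : X_ X -> Q.-integrable setT (EFin \o X).
  by move=> XX; exact: unif_integrable_integrable _ _ _ ui XX (mX_ _ XX).
split => // X U XX; split=> -[r r0 rU].
- have [r' r'0 r'r] := equiv_prob_dL0_lt _ _ _ PQ r0.
  by exists r' => // Y XY XYr'; apply: rU => //; apply: r'r => //; exact: iX_.
- have [r' r'0 r'r] := unif_integrable_dL1_lt _ _ _ _ PQ ui mX_ r0.
  by exists r' => // Y XY XYr'; apply: rU => //; exact: r'r.
Qed.

Lemma dL1_topology_convex_nbhd_base (hconv : convex_fset X_) (Q : probability T R) :
  equiv_prob P Q -> (forall X, X_ X -> Q.-integrable setT (EFin \o X)) ->
  (forall X U, X_ X -> (rel_nbhd (dL0 P) X_ X U <-> rel_nbhd (dL1 Q) X_ X U)) ->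
  forall X, X_ X -> convex_nbhd_base P X_ X.
Proof.
move=> PQ iX_ top X XX U /top => /(_ XX)[r r0 rU].
have mX_ Y : X_ Y -> measurable_fun setT Y by move=> /hX0[].
exists [set Y | X_ Y /\ dL1 Q X Y < r]; split.
- by move=> Y [].
- move=> Y Y' [XY XYr] mY' YY'; have XY' := hsat _ _ XY mY' YY'.
  split => //; rewrite -(@dL1_aeeq _ _ _ _ _ Y)//; [exact: mX_..|].
  exact: ae_equiv PQ YY'.
- move=> Y Z l [XY XYr] [XZ XZr] l01; split; first exact: hconv.
  apply: le_lt_trans (dL1_convex _ _ _ _ _ (iX_ _ XX) (iX_ _ XY) (iX_ _ XZ) l01) _.
  (* Strictness is taken from [Y], which requires [l > 0]; for [l = 0] the combination is [Z]. *)
  have /andP[] := l01; rewrite le_eqVlt => /predU1P[<- _|l0 l1].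
    by rewrite mul0r add0r subr0 mul1r.
  have : l * dL1 Q X Y < l * r by rewrite ltr_pM2l.
  have : (1 - l) * dL1 Q X Z <= (1 - l) * r by rewrite ler_wpM2l ?subr_ge0// ltW.
  by lra.
- by apply/top => //; exists r.
- by move=> Y [XY]; exact: rU.
Qed.

Lemma convex_nbhd_base_at0 (hsolid : solid P X_) :
  (forall X, X_ X -> convex_nbhd_base P X_ X) -> convex_nbhd_base P X_ (fun=> 0).
Proof.
(* If [X_] is empty, it does not contain 0 and the empty set serves as neighbourhood; otherwise
   solidity puts 0 into [X_]. *)
move=> base; have [X_0|/set0P[X XX]] := eqVneq X_ set0.
  move=> U _; exists set0; split => //.
  by exists 1 => // Y; rewrite X_0.
apply: base; apply: (hsolid X) => //.
  by split; [exact: measurable_cst|exact: aeW].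
by have [] := hX0 _ XX.
Qed.

End NeighbourhoodBases.

(** * Equivalent probabilities built from restrictions of [P] *)

Section WeightedRestrictions.
Context {d : measure_display} {T : measurableType d} {R : realType}.
Implicit Types (P Q : probability T R).

Lemma ge0_integral_mrestr (mu : {measure set T -> \bar R}) (B : set T)
    (mB : measurable B) (f : T -> \bar R) :
  measurable_fun setT f -> (forall x, (0 <= f x)%E) ->
  (\int[mrestr mu mB]_x f x = \int[mu]_(x in B) f x)%E.
Proof.
move=> mf f0; have mC := measurableC mB.
rewrite -(setUv B) ge0_integral_setU//.
- rewrite [X in (_ + X)%E](_ : _ = 0%E) ?adde0.
    by apply: eq_measure_integral => A _ AB; rewrite /= /mrestr setIidl.
  apply: null_set_integral => //; first exact: measurable_funTS.
  by rewrite /= /mrestr setICl measure0.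
- exact: measurable_funTS.
- exact/disj_setPCl.
Qed.

(* [Q] is the normalization of the measure [A |-> \sum_m c m * P (A `&` B m)]. *)
Lemma weighted_restrictions_probability P (B : nat -> set T) (c : nat -> R) :
  (forall m, measurable (B m)) ->
  (forall m, (P (~` B m) <= (1 / (2 ^ m)%:R : R)%:E)%E) ->
  (forall m, 0 < c m <= 1 / (2 ^ m.+1)%:R) ->
  exists (Q : probability T R) (C : R), [/\ equiv_prob P Q, 0 < C &
    forall f : T -> \bar R, measurable_fun setT f -> (forall x, (0 <= f x)%E) ->
      (\int[Q]_x f x <=
       C%:E * \sum_(0 <= m <oo) (c m)%:E * \int[P]_(x in B m) f x)%E].
Proof.
move=> mB PB cb; have c0 m : 0 <= c m by have /andP[/ltW] := cb m.
pose mu_ m : {measure set T -> \bar R} := mscale (NngNum (c0 m)) (mrestr P (mB m)).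
pose mu : {measure set T -> \bar R} := mseries mu_ 0.
have muE A : mu A = (\sum_(0 <= m <oo) (c m)%:E * P (A `&` B m))%E by [].
(* [mu A = 0] makes [A] [P]-null inside every [B m], and the complements of the [B m] have
   arbitrarily small probability. *)
have mu_P A : measurable A -> mu A = 0 -> P A = 0.
  move=> mA A0; have PAB m : P (A `&` B m) = 0.
    have : ((c m)%:E * P (A `&` B m) <= 0)%E.
      rewrite -A0 muE (@nneseriesD1 _ _ m)//; last first.
        by move=> k _; rewrite mule_ge0// lee_fin.
      by rewrite leeDl// nneseries_ge0// => k _ _; rewrite mule_ge0// lee_fin.
    rewrite pmule_rle0; last by rewrite lte_fin; have /andP[] := cb m.
    by move=> PAB0; apply/eqP; rewrite eq_le PAB0 measure_ge0.
  apply/eqP; rewrite eq_le measure_ge0 andbT; apply/lee_addgt0Pr => e e0.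
  have [m me] : exists m : nat, 1 / (2 ^ m)%:R < e.
    have [N _ /(_ N (leqnn N)) NE] := near_infty_natSinv_lt (PosNum e0).
    exists N; apply: le_lt_trans NE; rewrite div1r lef_pV2 ?posrE ?ltr0n ?expn_gt0//.
    by rewrite ler_nat; exact: ltn_expl.
  rewrite -(setIT A) -(setUv (B m)) setIUr add0e.
  apply: (@le_trans _ _ (P (A `&` B m) + P (A `&` ~` B m))%E).
    by apply: measureU2; apply: measurableI => //; exact: measurableC.
  rewrite PAB add0e; apply: (@le_trans _ _ (P (~` B m))).
    apply: le_measure; rewrite ?inE//; last exact: measurableC.
    by apply: measurableI => //; exact: measurableC.
  by apply: le_trans (PB m) _; rewrite lee_fin ltW.
have muT0 : mu setT != 0.
  by apply/eqP => /(mu_P _ measurableT)/eqP; rewrite probability_setT onee_eq0.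
have muT1 : (mu setT <= 1)%E.
  rewrite muE; apply: le_trans (epsilon_trick0 xpredT (ler01 : 0 <= 1 :> R)).
  apply: lee_nneseries => [m _ _|m _]; first by rewrite mule_ge0// lee_fin.
  apply: (@le_trans _ _ ((c m)%:E * 1)%E).
    apply: lee_wpmul2l; rewrite ?lee_fin//; apply: probability_le1.
    exact: measurableI.
  by rewrite mule1 lee_fin; have /andP[] := cb m.
have muTy : (mu setT < +oo)%E by apply: le_lt_trans muT1 (ltry _).
have muTf : mu setT \is a fin_num by rewrite ge0_fin_numE.
have C0 : 0 < (fine (mu setT))^-1.
  by rewrite invr_gt0 fine_gt0// muTy andbT lt0e muT0 measure_ge0.
pose Q : probability T R := mnormalize mu P.
have QE A : Q A = ((fine (mu setT))^-1%:E * mu A)%E.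
  rewrite /Q /= /mnormalize (negbTE muT0) /= lt_eqF//.
  by rewrite muleC.
exists Q, (fine (mu setT))^-1; split => //.
- move=> A mA; split=> [PA|QA].
    suff muA0 : mu A = 0 by rewrite QE muA0 mule0.
    rewrite muE eseries0// => m _ _.
    suff -> : P (A `&` B m) = 0 by rewrite mule0.
    apply/eqP; rewrite eq_le measure_ge0 andbT -PA.
    by apply: le_measure; rewrite ?inE//; exact: measurableI.
  apply: mu_P => //; move/eqP: QA; rewrite QE mule_eq0 eqe gt_eqF//= => /eqP//.
move=> f mf f0.
have -> : (\int[Q]_x f x = \int[mscale (NngNum (ltW C0)) mu]_x f x)%E.
  by apply: eq_measure_integral => A _ _; exact: QE.
rewrite ge0_integral_mscale//; apply: lee_wpmul2l; first by rewrite lee_fin ltW.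
rewrite ge0_integral_measure_series//; apply: lee_nneseries => [m _ _|m _].
  exact: integral_ge0.
by rewrite ge0_integral_mscale// ge0_integral_mrestr.
Qed.

End WeightedRestrictions.

(** * From a convex neighbourhood base at 0 to uniform integrability *)

Section ConvexBaseUniformIntegrability.
Context {d : measure_display} {T : measurableType d} {R : realType}.
Implicit Types (X : T -> R).

(** The absolute value makes a layer nonnegative everywhere, whereas members of [L0p P] are so only
    almost everywhere. *)
Definition layer X (a b : R) : T -> R :=
  (fun x => `|X x|) \_ [set x | a < `|X x| <= b].

Lemma layerE X a b x :
  layer X a b x = if a < `|X x| <= b then `|X x| else 0.
Proof.
rewrite /layer patchE; case: ifPn => [/set_mem/= -> //|].
by move=> /negP; rewrite inE/= => /negP/negbTE ->.
Qed.

Lemma layer_ge0 X a b x : 0 <= layer X a b x.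
Proof. by rewrite layerE; case: ifP. Qed.

Lemma layer_le X a b x : 0 <= b -> layer X a b x <= b.
Proof. by move=> b0; rewrite layerE; case: ifP => // /andP[]. Qed.

Lemma layer_le_norm X a b x : layer X a b x <= `|X x|.
Proof. by rewrite layerE; case: ifP. Qed.

Lemma measurable_layer X a b : measurable_fun setT X -> measurable_fun setT (layer X a b).
Proof.
move=> mX; have mn : measurable_fun setT (fun x => `|X x|).
  exact: measurableT_comp.
have mE : measurable [set x | a < `|X x| <= b].
  have -> : [set x | a < `|X x| <= b] =
      [set x | a < `|X x|] `\` [set x | b < `|X x|].
    apply/seteqP; split=> x /=.
      by move=> /andP[-> h]; split=> //; rewrite ltNge h.
    by move=> [-> /negP]; rewrite -leNgt.
  by apply: measurableD; exact: measurable_gt_set.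
by apply/(measurable_restrictT _ mE); exact: measurable_funTS.
Qed.

Context (P : probability T R) (X_ : set (T -> R)).
Context (hX0 : X_ `<=` L0p P) (hsolid : solid P X_) (hbdd : bounded_L0 P X_).

Lemma solid_layer X a b : X_ X -> X_ (layer X a b).
Proof.
move=> XX; have [mX Xge0] := hX0 _ XX.
apply: (hsolid X) => //.
  split; first exact: measurable_layer.
  by apply: aeW => x; exact: layer_ge0.
by apply: filterS Xge0 => x X0; rewrite -[leRHS]ger0_norm// layer_le_norm.
Qed.

(** In a convex neighbourhood inside the ball of radius [e * e], Markov's inequality at level
    [e < 1] gives the tail bound. A layer above [n] vanishes unless [|X| > n]; boundedness makes
    this so improbable, uniformly in [X], that the layer enters the neighbourhood whatever its upper
    end [b]. *)
Lemma small_convex_set_with_layers (e : R) :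
  convex_nbhd_base P X_ (fun=> 0) -> 0 < e < 1 ->
  exists VN : set (T -> R) * nat, [/\ convex_fset VN.1, VN.1 `<=` X_,
    forall Y, VN.1 Y -> (P [set x | (e < Y x)%R] <= e%:E)%E
    & forall n b X, (VN.2 <= n)%N -> X_ X -> VN.1 (layer X n%:R b)].
Proof.
move=> base /andP[e0 e1].
have [|V [VX _ Vc [r r0 rV] VU]] := base [set Y | dL0 P (fun=> 0) Y < e * e].
  by exists (e * e); rewrite ?mulr_gt0.
have [N HN] := hbdd _ (divr_gt0 r0 (ltr0n _ 2)).
exists (V, N); split => //=.
- move=> Y VY; have [mY _] := hX0 _ (VX _ VY).
  apply: (@le_trans _ _ (P [set x | (e < `|0 - Y x|)%R])).
    apply: le_measure; rewrite ?inE.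
    - exact: measurable_gt_set.
    - by apply: measurable_gt_set; apply: (measurable_dist (fun=> 0)).
    by move=> x /= eY; rewrite sub0r normrN; apply: lt_le_trans eY (ler_norm _).
  rewrite -(@lee_pmul2l _ e%:E)// ?lte_fin// -EFinM.
  apply: le_trans (dL0_markov P (fun=> 0) Y e _ mY _) _ => //.
    by rewrite e1 ltW.
  by rewrite lee_fin; exact/ltW/VU.
- move=> n b X Nn XX; apply: rV; first exact: solid_layer.
  have [mX _] := hX0 _ XX.
  have m0 : measurable_fun setT (fun _ : T => 0 : R) by exact: measurable_cst.
  rewrite -lte_fin.
  (* At level 0, the distance is at most the probability that the layer is nonzero. *)
  apply: le_lt_trans (dL0_le_tail P _ _ 0 m0 (measurable_layer _ _ _ mX) (lexx _)) _.
  rewrite add0e; apply: (@le_lt_trans _ _ (r / 2)%:E); last first.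
    by rewrite lte_fin ltr_pdivrMr// mulr_natr mulr2n ltrDl.
  apply: le_trans (HN n Nn X XX); apply: le_measure; rewrite ?inE.
  - by apply: measurable_gt_set; apply: measurable_dist => //; exact: measurable_layer.
  - by apply: measurable_gt_set; exact: measurableT_comp.
  move=> x /=; rewrite sub0r normrN layerE.
  by case: ifP => [/andP[]//|_]; rewrite normr0 ltxx.
Qed.

(** If [j + 1] is the least index with [|X x| <= nn (j + 1)], then [|X x|] is the value of layer
    [j], a single term of the series; [j >= k] because [nn k < |X x|]. *)
Lemma tail_le_sum_layers X (nn : nat -> R) k : {homo nn : i j / (i <= j)%N >-> i <= j} ->
  (forall y, exists j, y <= nn j) -> forall x, nn k < `|X x| ->
  ((`|X x|)%:E <= \sum_(0 <= i <oo) (layer X (nn (i + k)%N) (nn (i + k).+1) x)%:E)%E.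
Proof.
move=> nnm nnoo x kx.
have ex_j : exists j, `|X x| <= nn j by exact: nnoo.
case: (ex_minnP ex_j) => -[|j] xj jmin.
  by move: kx; rewrite ltNge (le_trans xj) ?nnm.
have jx : nn j < `|X x|.
  by rewrite ltNge; apply/negP => /jmin; rewrite ltnn.
have kj : (k <= j)%N.
  by rewrite leqNgt; apply/negP => jk; move: kx; rewrite ltNge (le_trans xj) ?nnm.
rewrite (@nneseriesD1 _ _ (j - k)%N)//; last first.
  by move=> i _; rewrite lee_fin layer_ge0.
rewrite subnK// layerE jx xj/= leeDl// nneseries_ge0// => i _ _.
by rewrite lee_fin layer_ge0.
Qed.

Lemma convex_nbhd_base0_unif_integrable : convex_nbhd_base P X_ (fun=> 0) ->
  exists Q : probability T R, equiv_prob P Q /\ unif_integrable Q X_.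
Proof.
move=> base; pose u (j : nat) : R := 1 / (2 ^ j.+1)%:R.
have u0 j : 0 < u j by rewrite /u div1r invr_gt0 ltr0n expn_gt0.
have u1 j : u j < 1.
  by rewrite /u div1r invf_lt1 ?ltr0n ?expn_gt0// ltr1n -[1%N]/(2 ^ 0)%N ltn_exp2l.
have step j := small_convex_set_with_layers (u j) base.
have {}step j : exists VN : set (T -> R) * nat, [/\ convex_fset VN.1, VN.1 `<=` X_,
    forall Y, VN.1 Y -> (P [set x | (u j < Y x)%R] <= (u j)%:E)%E
    & forall n b X, (VN.2 <= n)%N -> X_ X -> VN.1 (layer X n%:R b)].
  by apply: step; rewrite u0 u1.
have {step}[VN VNP] := choice step.
(* Partial sums dominate the thresholds [(VN j).2]; the successors make them strictly increasing. *)
pose n_ (j : nat) := (\sum_(i < j.+1) (VN i).2.+1)%N.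
have n_VN j : ((VN j).2 <= n_ j)%N.
  by rewrite /n_ big_ord_recr/= (leq_trans (leqnSn _))// leq_addl.
have n_S j : (n_ j < n_ j.+1)%N.
  by rewrite /n_ [ltnRHS]big_ord_recr/= -[ltnLHS]addn0 ltn_add2l.
have n_homo : {homo n_ : i j / (i <= j)%N}.
  by apply: homo_leq => [//|j i k|j]; [exact: leq_trans|exact/ltnW/n_S].
have n_ge j : (j <= n_ j)%N.
  by elim: j => // j IH; apply: leq_ltn_trans IH (n_S j).
pose nn j : R := (n_ j)%:R.
have nn_ge0 j : 0 <= nn j by [].
have nn_homo : {homo nn : i j / (i <= j)%N >-> i <= j}.
  by move=> i j ij; rewrite ler_nat n_homo.
have nn_oo y : exists j, y <= nn j.
  exists (Num.truncn y).+1; apply: (@le_trans _ _ (Num.truncn y).+1%:R).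
    exact/ltW/truncnS_gt.
  by rewrite ler_nat.
pose F j X := layer X (nn j) (nn j.+1).
have AP j : exists A : set T, [/\ measurable A, (P (~` A) <= (u j)%:E)%E &
    forall X, X_ X -> (\int[P]_(x in A) (F j X x)%:E <= (3 * u j)%:E)%E].
  have [Vc VX VP VF] := VNP j.
  (* The almost-maximizer argument needs a uniform bound; the layers satisfy this one. *)
  pose K := [set X | (VN j).1 X /\ forall x, 0 <= X x <= nn j.+1].
  have [A [mA PA AK]] : exists A : set T, [/\ measurable A,
      (P (~` A) <= (u j)%:E)%E &
      forall X, K X -> (\int[P]_(x in A) (X x)%:E <= (3 * u j)%:E)%E].
    apply: (convex_tail_integral_bound P K (u j) (u j) (nn j.+1) (u0 j)).
    - by rewrite ltr0n (leq_ltn_trans _ (n_S j)).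
    - exact: ltW.
    - move=> X Y l [VX1 X1] [VY1 Y1] /[dup] l01 /andP[l0 l1].
      split; first exact: Vc.
      move=> x; have /andP[X0 XM] := X1 x; have /andP[Y0 YM] := Y1 x.
      by apply/andP; split; nra.
    - by move=> X [/VX/hX0[]].
    - by move=> X [VX1 _]; exact: VP.
  exists A; split => // X XX; apply: AK; split; first exact: VF.
  by move=> x; rewrite layer_ge0 layer_le.
have {AP}[A AP] := choice AP.
have mA j : measurable (A j) by have [] := AP j.
(* On [B m] the bounds for all layers [j >= m] hold at once; its complement costs at most the sum of
   [u j] over [j >= m], which is [2^-m]. *)
pose B m := \bigcap_i A (i + m)%N.
have mB m : measurable (B m) by exact: bigcapT_measurable.
have BA m j : (m <= j)%N -> B m `<=` A j.
  by move=> mj x /(_ (j - m)%N I); rewrite subnK.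
have ushift m i : u (i + m)%N = 1 / (2 ^ m)%:R / (2 ^ i.+1)%:R.
  by rewrite /u -addSn expnD natrM invfM mulrA mulrAC.
have PB m : (P (~` B m) <= (1 / (2 ^ m)%:R : R)%:E)%E.
  rewrite setC_bigcap.
  apply: (@le_trans _ _ (\sum_(0 <= i <oo) P (~` A (i + m)%N))%E).
    apply: measure_sigma_subadditive => //.
    - by move=> i; exact: measurableC.
    - by apply: bigcup_measurable => i _; exact: measurableC.
  have e0 : 0 <= 1 / (2 ^ m)%:R :> R by rewrite divr_ge0.
  apply: le_trans (epsilon_trick0 xpredT e0).
  apply: lee_nneseries => [i _ _|i _]; first exact: measure_ge0.
  by have [_ h _] := AP (i + m)%N; rewrite -ushift.
(* With these weights [c m * \int_(B m) F j X <= 3 * u m * u j] for all [m] and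
   [j]: through the bound on [A j] if [m <= j], else through [F j X <= nn m]. *)
pose c m := u m / (2 ^ m)%:R / (nn m + 1).
have nn1 m : 0 < nn m + 1 by rewrite ltr_wpDl.
have p0 m : 0 < (2 ^ m)%:R :> R by rewrite ltr0n expn_gt0.
have c0 m : 0 < c m by rewrite !divr_gt0.
have cu m : c m <= u m.
  rewrite /c -mulrA ger_pMr// -invfM invf_le1 ?mulr_gt0//.
  by rewrite mulr_ege1// ?ler1n ?expn_gt0// lerDr.
have [|Q [C [PQ C0 QC]]] := weighted_restrictions_probability P B c mB PB.
  by move=> m; rewrite c0 cu.
exists Q; split => // e e0.
have mF j X : X_ X -> measurable_fun setT (EFin \o F j X).
  by move=> /hX0[mX _]; apply/measurable_EFinP; exact: measurable_layer.
have cF m j X : X_ X ->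
    ((c m)%:E * \int[P]_(x in B m) (F j X x)%:E <= (3 * u j * u m)%:E)%E.
  move=> XX; have [mj|jm] := leqP m j.
    have [_ _ /(_ X XX) AF] := AP j.
    apply: (@le_trans _ _ ((u m)%:E * (3 * u j)%:E)%E); last first.
      by rewrite -EFinM lee_fin mulrC.
    apply: lee_pmul; rewrite ?lee_fin ?(ltW (c0 m))//.
      by apply: integral_ge0 => x _; rewrite lee_fin layer_ge0.
    apply: le_trans AF; apply: ge0_subset_integral => //; last exact: BA.
      by apply: measurable_funTS; exact: mF.
    by move=> x _; rewrite lee_fin layer_ge0.
  apply: (@le_trans _ _ ((c m)%:E * (nn m)%:E)%E).
    apply: lee_wpmul2l; first by rewrite lee_fin ltW.
    apply: (@le_trans _ _ (\int[P]_(x in B m) (nn m)%:E)%E).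
      apply: ge0_le_integral => //.
      - by move=> x _; rewrite lee_fin layer_ge0.
      - by apply: measurable_funTS; exact: mF.
      by move=> x _; rewrite lee_fin (le_trans (layer_le _ _ _ _ _))// nn_homo.
    rewrite integral_cst// -[leRHS]mule1; apply: lee_wpmul2l; first by rewrite lee_fin.
    exact: probability_le1.
  rewrite -EFinM lee_fin /c.
  (* As [j < m], the factor [2^-m] of [c m] supplies [u j], while [nn m + 1] absorbs the bound
     [nn m] on the layer. *)
  have uj : ((2 ^ m)%:R)^-1 <= u j.
    by rewrite /u div1r lef_pV2 ?posrE// ler_nat leq_exp2l.
  move: (u j) (u m) (u0 j) (u0 m) uj => v w v0 w0 mv.
  apply: (@le_trans _ _ (w * v)); last by nra.
  rewrite -!mulrA ler_pM2l//.
  apply: (@le_trans _ _ ((2 ^ m)%:R^-1)) => //.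
  rewrite ger_pMr ?invr_gt0// mulrC ler_pdivrMr// mul1r lerDl//.
have QF j X : X_ X -> (\int[Q]_x (F j X x)%:E <= (C * (3 * u j))%:E)%E.
  move=> XX; apply: le_trans (QC _ (mF j X XX) _) _.
    by move=> x; rewrite lee_fin layer_ge0.
  rewrite EFinM; apply: lee_wpmul2l; first by rewrite lee_fin ltW.
  have uj0 : 0 <= 3 * u j by rewrite mulr_ge0// ltW.
  (* The factors [u m] sum to 1, which leaves [3 * u j]. *)
  apply: le_trans (epsilon_trick0 xpredT uj0).
  apply: lee_nneseries => [m _ _|m _].
    rewrite mule_ge0// ?lee_fin ?(ltW (c0 m))//.
    by apply: integral_ge0 => x _; rewrite lee_fin layer_ge0.
  by apply: le_trans (cF m j X XX) _; rewrite lee_fin [u m]/u div1r.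
(* [C * 3 * 2^-k] is the sum over [j >= k] of the bounds [C * (3 * u j)] for the layers above
   [nn k]. *)
have [k ke] : exists k : nat, C * 3 * (1 / (2 ^ k)%:R) <= e.
  have e'0 : 0 < e / (C * 3) by rewrite divr_gt0// mulr_gt0.
  have [k _ /(_ k (leqnn k)) kE] := near_infty_natSinv_lt (PosNum e'0).
  exists k; rewrite mulrC -ler_pdivlMr ?mulr_gt0//; apply: le_trans (ltW kE).
  rewrite div1r lef_pV2 ?posrE// ler_nat; exact: ltn_expl.
exists (n_ k) => n kn X XX; have [mX _] := hX0 _ XX.
have mnX : measurable_fun setT (fun x => `|X x|) by exact: measurableT_comp.
have msum : measurable_fun setT (fun x => \sum_(0 <= i <oo) (F (i + k)%N X x)%:E)%E.
  apply: ge0_emeasurable_sum => [i x _ _|i _]; first by rewrite lee_fin layer_ge0.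
  exact: mF.
have sum0 x : (0 <= \sum_(0 <= i <oo) (F (i + k)%N X x)%:E)%E.
  by apply: nneseries_ge0 => i _ _; rewrite lee_fin layer_ge0.
have mtail : measurable [set x | n%:R < `|X x|] by exact: measurable_gt_set.
apply: (@le_trans _ _ (\int[Q]_x \sum_(0 <= i <oo) (F (i + k)%N X x)%:E)%E).
  apply: (@le_trans _ _ (\int[Q]_(x in [set x | (n%:R < `|X x|)%R])
      \sum_(0 <= i <oo) (F (i + k)%N X x)%:E)%E); last first.
    exact: ge0_subset_integral.
  apply: ge0_le_integral => //.
  - by apply/measurable_EFinP; exact: measurable_funTS.
  - exact: measurable_funTS.
  move=> x /= nx; apply: tail_le_sum_layers => //.
  by apply: le_lt_trans nx; rewrite ler_nat.
rewrite integral_nneseries//; [|by move=> i; exact: mF|]; last first.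
  by move=> i x _; rewrite lee_fin layer_ge0.
apply: (@le_trans _ _ (C * 3 * (1 / (2 ^ k)%:R))%:E); last by rewrite lee_fin.
have Ck0 : 0 <= C * 3 * (1 / (2 ^ k)%:R).
  by rewrite mulr_ge0// ?divr_ge0// mulr_ge0// ltW.
apply: le_trans (epsilon_trick0 xpredT Ck0).
apply: lee_nneseries => [i _ _|i _].
  by apply: integral_ge0 => x _; rewrite lee_fin layer_ge0.
by apply: le_trans (QF _ _ XX) _; rewrite lee_fin ushift !mulrA.
Qed.

End ConvexBaseUniformIntegrability.

Theorem theorem3p2 (d : measure_display) (T : measurableType d) (R : realType)
  (P : probability T R) (X_ : set (T -> R))
  (hX0 : X_ `<=` L0p P) (hsat : saturated P X_)
  (hconv : convex_fset X_) (hsolid : solid P X_) (hbdd : bounded_L0 P X_) :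
  [<->
    (* (1) *)
    (forall Xs : nat -> T -> R, (forall n, X_ (Xs n)) -> cvg0_L0 P Xs ->
       forall Ys : nat -> T -> R, (forall n, fwd_conv Xs n (Ys n)) ->
       cvg0_L0 P Ys);
    (* (2) *)
    convex_nbhd_base P X_ (fun=> 0);
    (* (3) *)
    (forall X, X_ X -> convex_nbhd_base P X_ X);
    (* (4) *)
    (exists Q : probability T R, [/\ equiv_prob P Q,
       (forall X, X_ X -> Q.-integrable setT (EFin \o X))
       & forall X U, X_ X ->
           (rel_nbhd (dL0 P) X_ X U <-> rel_nbhd (dL1 Q) X_ X U)]);
    (* (5) *)
    (exists Q : probability T R, equiv_prob P Q /\ unif_integrable Q X_)
  ].
Proof.
have h25 := convex_nbhd_base0_unif_integrable P X_ hX0 hsolid hbdd.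
have h54 : (exists Q : probability T R, equiv_prob P Q /\ unif_integrable Q X_) ->
    exists Q : probability T R, [/\ equiv_prob P Q,
      (forall X, X_ X -> Q.-integrable setT (EFin \o X))
      & forall X U, X_ X -> (rel_nbhd (dL0 P) X_ X U <-> rel_nbhd (dL1 Q) X_ X U)].
  move=> [Q [PQ ui]]; exists Q.
  by have [? ?] := unif_integrable_dL1_topology P X_ hX0 Q PQ ui; split.
have h43 : (exists Q : probability T R, [/\ equiv_prob P Q,
      (forall X, X_ X -> Q.-integrable setT (EFin \o X))
      & forall X U, X_ X -> (rel_nbhd (dL0 P) X_ X U <-> rel_nbhd (dL1 Q) X_ X U)]) ->
    forall X, X_ X -> convex_nbhd_base P X_ X.
  by move=> [Q [PQ iX top]]; exact: dL1_topology_convex_nbhd_base iX top.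
have h32 := convex_nbhd_base_at0 P X_ hX0 hsolid.
(* (2) to (5) to (4) to (3) and back to (2) is a cycle, to which (1) is joined through (2). *)
tfae.
- exact: fwd_conv_convex_nbhd_base0.
- by move=> /h25/h54/h43.
- by move=> /h32/h25/h54.
- by move=> /h43/h32/h25.
- by move=> /h54/h43/h32/convex_nbhd_base0_fwd_conv.
Qed.
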